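(* Let $X$ be a compact Hausdorff space, let $T:X\to X$ be a surjective continuous map, and let $G$ be ${\mathbb Z}_{\geq 0}$ (or ${\mathbb Z}$, in which case $T$ is assumed to be a homeomorphism), acting on $X$ by $n\cdot x=T^n x$. Let $k\geq 2$ and let $(x_1,\dots,x_k)\in X^k\setminus\Delta_k(X)$. Then $(x_1,\dots,x_k)$ is an entropy tuple if and only if it is an IE-tuple.
   Context: $\Delta_k(X)=\{(x,\dots,x)\in X^k: x\in X\}$. For an open cover ${\mathcal U}$ of $X$, $N({\mathcal U})$ is the minimal cardinality of a subcover, and the topological entropy of ${\mathcal U}$ is ${\rm h}_{\rm top}(T,{\mathcal U})=\lim_{n\to\infty}\frac1n\ln N({\mathcal U}\vee T^{-1}{\mathcal U}\vee\cdots\vee T^{-n+1}{\mathcal U})$. A tuple $(x_1,\dots,x_k)\in X^k\setminus\Delta_k(X)$ is an entropy tuple if whenever $U_1,\dots,U_l$ are closed pairwise disjoint neighbourhoods of the distinct points in the list $x_1,\dots,x_k$, the open cover $\{U_1^{\rm c},\dots,U_l^{\rm c}\}$ has positive topological entropy. For a tuple $(A_1,\dots,A_k)$ of subsets of $X$, a set $J\subseteq G$ is an independence set for it if for every nonempty finite $I\subseteq J$ and every $\sigma:I\to\{1,\dots,k\}$ one has $\bigcap_{s\in I}T^{-s}A_{\sigma(s)}\neq\emptyset$. A set $I\subseteq{\mathbb Z}$ has positive density if $\lim_{n\to\infty}|I\cap\{-n,\dots,n\}|/(2n+1)$ exists and is nonzero; a set $I\subseteq{\mathbb Z}_{\ge0}$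 has positive density if $\lim_{n\to\infty}|I\cap\{0,\dots,n\}|/(n+1)$ exists and is nonzero. A tuple $(x_1,\dots,x_k)\in X^k$ is an IE-tuple if for every product neighbourhood $U_1\times\cdots\times U_k$ of it, the tuple $(U_1,\dots,U_k)$ has an independence set of positive density. *)

(* Defs.v *)
From HB Require Import structures.
From mathcomp Require Import all_boot all_order all_algebra.
From mathcomp Require Import all_classical all_reals all_analysis.
Set Implicit Arguments. Unset Strict Implicit. Unset Printing Implicit Defensive.
Import Order.TTheory GRing.Theory Num.Theory.
Import numFieldNormedType.Exports.
Local Open Scope classical_set_scope.
Local Open Scope ring_scope.

Section Dynamics.
Context {X : topologicalType}.

Definition join_iter (T : X -> X) (U : set (set X)) (n : nat) : set (set X) :=
  [set W | exists f : nat -> set X, (forall i, (i < n)%N -> U (f i)) /\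
      W = \bigcap_(i in [set i : nat | (i < n)%N]) (iter i T @^-1` f i)].

Definition subcover_of_size (U : set (set X)) (n : nat) : Prop :=
  exists s : 'I_n -> set X, (forall i, U (s i)) /\ (forall x, exists i, s i x).

Definition covnum (U : set (set X)) : nat :=
  xget 0%N [set n | subcover_of_size U n /\
                    forall m, subcover_of_size U m -> (n <= m)%N].

Definition htop_cover (R : realType) (T : X -> X) (U : set (set X)) : R :=
  limn (fun n : nat => ln ((covnum (join_iter T U n))%:R : R) / n%:R : R).

Definition entropy_tuple (R : realType) (T : X -> X) (k : nat) (x : 'I_k -> X) : Prop :=
  ~ (forall i j, x i = x j) /\
  forall V : X -> set X,
    (forall i, closed (V (x i))) ->
    (forall i, nbhs (x i) (V (x i))) ->
    (forall i j, x i <> x j -> V (x i) `&` V (x j) = set0) ->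
    0 < htop_cover R T [set ~` V (x i) | i in [set: 'I_k]].

Definition indep_set (G : Type) (act : G -> X -> X) (k : nat)
    (A : 'I_k -> set X) (J : set G) : Prop :=
  forall I : set G, finite_set I -> I !=set0 -> I `<=` J ->
    forall sigma : G -> 'I_k, exists y, forall s, I s -> A (sigma s) (act s y).

Definition IE_tuple (G : Type) (act : G -> X -> X) (dens : set G -> Prop)
    (k : nat) (x : 'I_k -> X) : Prop :=
  forall U : 'I_k -> set X, (forall i, nbhs (x i) (U i)) ->
    exists J : set G, indep_set act U J /\ dens J.

Definition act_nat (T : X -> X) (n : nat) (y : X) : X := iter n T y.
Definition act_int (T Tinv : X -> X) (z : int) (y : X) : X :=
  match z with Posz n => iter n T y | Negz n => iter n.+1 Tinv y end.

End Dynamics.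

Definition pos_density_nat (R : realType) (I : set nat) : Prop :=
  exists2 d : R, d != 0 &
    (fun n : nat => ((\sum_(i < n.+1) nat_of_bool `[< I i >])%N)%:R / (n.+1)%:R)
      @ \oo --> d.

Definition pos_density_int (R : realType) (I : set int) : Prop :=
  exists2 d : R, d != 0 &
    (fun n : nat => ((\sum_(i < (2 * n).+1)
                        nat_of_bool `[< I (i%:Z - n%:Z)%R >])%N)%:R / ((2 * n).+1)%:R)
      @ \oo --> d.

(* Main.v *)
Require Import Defs.
From HB Require Import structures.
From mathcomp Require Import all_boot all_order all_algebra.
From mathcomp Require Import all_classical all_reals all_analysis.
From mathcomp Require Import ring lra zify.
Set Implicit Arguments. Unset Strict Implicit. Unset Printing Implicit Defensive.
Import Order.TTheory GRing.Theory Num.Theory.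
Import numFieldNormedType.Exports.
Local Open Scope classical_set_scope.
Local Open Scope ring_scope.

(**
  Let [N_n] be the size of a minimal subcover of the [n]-th join of the cover
  [{V_1^c, ..., V_k^c}], and call a set [E] of times shattered by [Y] if every
  labelling of [E] is realised on [E] by the orbit of a point of [Y].

  IE implies entropy: an element of the join meets at most [(k-1)^#|E|] of the
  [k^#|E|] labellings of a shattered [E], so an independence set of density [d]
  gives entropy at least [d * ln (k / (k-1))].

  Entropy implies IE: let [F_n Y] be the number of elements of the [n]-th join
  needed to cover [Y] and [phi_n Y] the number of subsets of [{0..n-1}] that [Y]
  shatters. For each [b > 1] there is an exponent [a] with
  [F_n Y <= b^n * (phi_n Y)^a]. Indeed a set shattered by each of the slices
  [Y_j = Y `&` T^-n V_j] remains so with the time [n] added; hence some slice has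
  [phi_n Y_j <= g * phi_(n+1) Y] for a constant [g < 1], and one inducts on
  [F_(n+1) Y <= F_n Y_j + F_n (Y `\` Y_j)] with [g^a <= b - 1]. So positive
  entropy forces exponentially many, hence linearly large, shattered sets.
  If [d > 0] is the limit of the maximal densities of independence sets in
  [{0..n-1}], cutting into blocks yields for each [e > 0] independence sets all
  of whose prefixes have density at least [d - e], and a limit along an
  ultrafilter is an independence set of density exactly [d]. Seen inside the
  integers it has density [d / 2].
*)

(** * Shattered sets of times and the combinatorial covering bound *)

Section Shattering.
Variables (X : Type) (k N : nat) (P : nat -> 'I_k -> set X).

Definition shatters (Y : set X) (E : {set 'I_N}) : Prop :=
  forall c : 'I_N -> 'I_k,
    exists2 y, Y y & forall t, t \in E -> P t (c t) y.

(** All stages [n] share the ambient ['I_N], so their families live in one finite type and can be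
    compared. *)
Definition shattered (n : nat) (Y : set X) : {set {set 'I_N}} :=
  [set E : {set 'I_N} | [forall t in E, (t < n)%N] && `[< shatters Y E >]]%SET.

Lemma shatteredP n Y (E : {set 'I_N}) :
  reflect ((forall t, t \in E -> (t < n)%N) /\ shatters Y E)
          (E \in shattered n Y).
Proof.
rewrite inE; apply: (iffP andP) => -[H1 H2]; split.
- by move=> t tE; move/forallP: H1 => /(_ t); rewrite tE.
- exact/asboolP.
- by apply/forallP => t; apply/implyP; apply: H1.
- exact/asboolP.
Qed.

Lemma shattered_sub m n Y Y' : (m <= n)%N -> Y `<=` Y' ->
  shattered m Y \subset shattered n Y'.
Proof.
move=> mn YY'; apply/fintype.subsetP => E /shatteredP[Em Es].
apply/shatteredP; split => [t /Em|c]; first by move/leq_trans; apply.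
by have [y /YY' Yy Ey] := Es c; exists y.
Qed.

(* A set shattered by every slice [Y `&` P n j] stays shattered when the
   coordinate [n] is added to it. *)
Lemma card_shatteredS (n : 'I_N) Y (j0 : 'I_k) :
  (#|shattered n Y| + #|(\bigcap_(j : 'I_k) shattered n (Y `&` P n j))%SET|
     <= #|shattered n.+1 Y|)%N.
Proof.
set D := shattered n Y; set I := (\bigcap_j _)%SET.
have IP (E : {set 'I_N}) : E \in I ->
    (forall t, t \in E -> (t < n)%N) /\ forall j, shatters (Y `&` P n j) E.
  move=> /finset.bigcapP EI; split=> [|j].
    by have /shatteredP[] := EI j0 isT.
  by have /shatteredP[] := EI j isT.
have nI (E : {set 'I_N}) : E \in I -> n \notin E.
  by move=> /IP[En _]; apply/negP => /En; rewrite ltnn.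
pose add (E : {set 'I_N}) := (n |: E)%SET.
have inj : {in I &, injective add}.
  by move=> E F EI FI /(congr1 (fun E => E :\ n)%SET); rewrite !setU1K ?nI.
rewrite -(card_in_imset inj) -cardsUI.
have -> : (D :&: add @: I = finset.set0)%SET.
  apply/setP => E; rewrite !inE; apply/negP => /andP[/andP[/forallP/(_ n) EN _]].
  by move=> /imsetP[F _ EF]; move: EN; rewrite EF !inE eqxx /= ltnn.
rewrite cards0 addn0; apply/subset_leq_card/fintype.subsetP => E.
rewrite inE => /orP[|/imsetP[F FI ->]].
  by apply/fintype.subsetP; apply: shattered_sub.
have [Fn Fs] := IP _ FI; apply/shatteredP; split => [t|c].
  by rewrite !inE => /orP[/eqP->//|/Fn/ltnW].
have [y [Yy Pn] Fy] := Fs (c n) c.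
by exists y => // t; rewrite !inE => /orP[/eqP->|/Fy].
Qed.

(** Union bound: an element of [D] outside the intersection is missing from some [A j]. *)
Lemma card_bigcap_ge (S : finType) (D : {set S}) (A : 'I_k -> {set S}) :
  (forall j, A j \subset D) ->
  (#|D| + \sum_j #|A j| <= #|(\bigcap_j A j)%SET| + k * #|D|)%N.
Proof.
move=> AD; have dA j : (#|A j| + #|(D :\: A j)%SET| = #|D|)%N.
  by rewrite -(cardsID (A j) D) (finset.setIidPr (AD j)).
have -> : (k * #|D| = \sum_j #|A j| + \sum_j #|(D :\: A j)%SET|)%N.
  rewrite -big_split /= (eq_bigr (fun=> #|D|)) => [|j _]; last exact: dA.
  by rewrite sum_nat_const card_ord.
suff: (#|D| <= #|(\bigcap_j A j)%SET| + \sum_j #|(D :\: A j)%SET|)%N by lia.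
have /subset_leq_card/leq_trans :
    D \subset ((\bigcap_j A j) :|: \bigcup_j (D :\: A j))%SET.
  apply/fintype.subsetP => x xD; rewrite inE; apply/orP.
  have [h|h] := boolP [forall j, x \in A j]; [left|right].
    by apply/finset.bigcapP => j _; apply: (forallP h).
  by move: h => /forallPn[j xA]; apply/finset.bigcupP; exists j; rewrite ?inE ?xA.
apply; apply: leq_trans (leq_card_setU _ _) _; rewrite leq_add2l.
elim/big_ind2: _ => [|a A1 b B1 h1 h2|//]; first by rewrite cards0.
by apply: leq_trans (leq_card_setU _ _) _; apply: leq_add.
Qed.

Variable R : realType.

(* If all slices had more, the intersection of their families of shattered sets
   would be too large for [card_shatteredS]. *)
Lemma small_slice (n : 'I_N) Y (g : R) : (1 < k)%N ->
  1 - k%:R^-1 < g ->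
  exists j, #|shattered n (Y `&` P n j)|%:R <= g * #|shattered n.+1 Y|%:R.
Proof.
move=> k1 gk; have k0 := ltnW k1; apply: contrapT => /forallNP hs.
pose j0 : 'I_k := Ordinal k0.
have {}hs j : g * #|shattered n.+1 Y|%:R < #|shattered n (Y `&` P n j)|%:R.
  by rewrite ltNge; apply/negP/hs.
set f := #|shattered n.+1 Y| in hs.
have sub j : shattered n (Y `&` P n j) \subset shattered n Y.
  by apply: shattered_sub => // y [].
have := card_shatteredS n Y j0; have := card_bigcap_ge sub.
rewrite -/f; set M := #|shattered n Y|; set I := #|_| => h1 h2.
have hM : (M <= f)%N by lia.
have hS : k%:R * (g * f%:R) < (\sum_j #|shattered n (Y `&` P n j)|)%N%:R :> R.
  rewrite natr_sum -[X in X%:R * _]card_ord mulr_natl -sumr_const.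
  by apply: ltr_sum => [|j _]; [apply/hasP; exists j0; rewrite ?mem_index_enum|].
have {h1 h2} h3 : (2 * M + \sum_j #|shattered n (Y `&` P n j)| <= f + k * M)%N.
  by lia.
have k0' : 0 < k%:R :> R by rewrite ltr0n.
(* [M <= f] and [1 < k] bound [f + (k - 2) * M] by [(k - 1) * f]. *)
have {}h3 : (\sum_j #|shattered n (Y `&` P n j)| <= k.-1 * f)%N by nia.
have : k.-1%:R * f%:R <= k%:R * (g * f%:R).
  rewrite mulrA ler_wpM2r // -subn1 natrB //.
  have -> : k%:R - 1 = k%:R * (1 - k%:R^-1) :> R.
    by rewrite mulrBr mulr1 mulfV // lt0r_neq0.
  by rewrite ler_pM2l // ltW.
by rewrite leNgt; move/negP; apply; apply: lt_le_trans hS _; rewrite -natrM ler_nat.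
Qed.

(** A word stands for the set of points avoiding its label at every time below [n]. [Y] stays
    general because the induction is applied to a slice and to its complement. *)
Lemma cover_le_shattered (b g : R) (a : nat) :
  (1 < k)%N -> 1 < b -> 0 <= g -> 1 - k%:R^-1 < g -> g ^+ a <= b - 1 ->
  (forall j, exists j', forall t y, P t j y -> ~ P t j' y) ->
  forall n Y, (n <= N)%N ->
  exists2 ws : seq {ffun 'I_N -> 'I_k},
    (size ws)%:R <= b ^+ n * #|shattered n Y|%:R ^+ a &
    forall y, Y y -> exists2 w, w \in ws & forall t : 'I_N, (t < n)%N -> ~ P t (w t) y.
Proof.
move=> k1 b1 g0 gk gab dis; have k0 := ltnW k1; have b0 : 0 <= b by lra.
elim=> [|n IH] Y nN.
  have [[y Yy]|nY] := pselect (exists y, Y y); last first.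
    (* An empty [Y] shatters nothing, so the bound may vanish and the list has to be empty. *)
    by exists [::] => [|y Yy]; [rewrite mulr_ge0 ?exprn_ge0|case: nY; exists y].
  exists [:: [ffun=> Ordinal k0]] => [|z _]; last first.
    by exists [ffun=> Ordinal k0] => //; rewrite inE.
  rewrite expr0 mul1r /=; apply: exprn_ege1; rewrite ler1n card_gt0.
  apply/set0Pn; exists finset.set0; apply/shatteredP.
  by split=> [t|c]; [rewrite inE|exists y => // t; rewrite inE].
pose t0 := Ordinal nN.
have [j hj] := small_slice t0 Y k1 gk; rewrite /= in hj.
have [j' dj] := dis j.
have [wA sA cA] := IH (Y `&` P n j) (ltnW nN).
have [wB sB cB] := IH (Y `&` ~` P n j) (ltnW nN).
(* At the new time [n], words for the slice [P n j] receive a label [j'] whose set is disjoint from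
   it, the other words the label [j] itself. *)
pose upd i (w : {ffun 'I_N -> 'I_k}) : {ffun 'I_N -> 'I_k} :=
  [ffun t => if t == t0 then i else w t].
exists (map (upd j') wA ++ map (upd j) wB) => [|y Yy].
  rewrite size_cat !size_map natrD; apply: le_trans (lerD sA sB) _.
  rewrite -mulrDr exprSr -mulrA ler_wpM2l ?exprn_ge0 //.
  set f := #|shattered n.+1 Y|%:R in hj *.
  have f0 : 0 <= f :> R by rewrite /f.
  have -> : b * f ^+ a = (b - 1) * f ^+ a + f ^+ a by ring.
  apply: lerD.
    apply: le_trans (_ : (g * f) ^+ a <= _); first by rewrite lerXn2r ?nnegrE ?mulr_ge0.
    by rewrite exprMn ler_wpM2r ?exprn_ge0.
  by rewrite lerXn2r ?nnegrE // ler_nat subset_leq_card // shattered_sub //.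
have agree i (w : {ffun 'I_N -> 'I_k}) :
    (forall t : 'I_N, (t < n)%N -> ~ P t (w t) y) -> ~ P n i y ->
    forall t : 'I_N, (t < n.+1)%N -> ~ P t (upd i w t) y.
  move=> h1 h2 t; rewrite ltnS leq_eqVlt ffunE => /orP[/eqP tn|tn].
    have -> : t = t0 by apply/val_inj.
    by rewrite eqxx.
  have -> : (t == t0) = false by apply/eqP => tt0; rewrite tt0 ltnn in tn.
  exact: h1.
have [Py|Py] := pselect (P n j y).
  have [w ww hw] := cA y (conj Yy Py); exists (upd j' w).
    by rewrite mem_cat map_f.
  by apply: agree => //; apply: dj.
have [w ww hw] := cB y (conj Yy Py); exists (upd j w).
  by rewrite mem_cat map_f ?orbT.
exact: agree.
Qed.

End Shattering.

(** * Weighted counting of small sets, and subadditive sequences *)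

Lemma sum_expr_card (R : realType) (N : nat) (q : R) :
  \sum_(E : {set 'I_N}) q ^+ #|E| = (1 + q) ^+ N.
Proof.
rewrite addrC -[in RHS](card_ord N) -prodr_const.
rewrite (eq_bigl predT) // bigA_distr; apply: eq_big => // E _.
by rewrite -big_mkcond /= prodr_const.
Qed.

(** Give each set the weight [q ^+ #|E|]: members of [F] weigh at least [q ^+ d] because [q <= 1],
    and all sets together weigh [(1 + q) ^+ N]. *)
Lemma card_small_sets (R : realType) (N d : nat) (q : R)
    (F : {set {set 'I_N}}) : 0 < q -> q <= 1 ->
  (forall E, E \in F -> (#|E| <= d)%N) ->
  #|F|%:R * q ^+ d <= (1 + q) ^+ N.
Proof.
move=> q0 q1 Fd; rewrite -sum_expr_card mulr_natl -sumr_const.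
apply: le_trans (_ : \sum_(E in F) q ^+ #|E| <= _).
  apply: ler_sum => E /Fd; apply: ler_wiXn2l => //; exact: ltW.
rewrite [leRHS](bigID (mem F)) /= lerDl sumr_ge0 // => E _.
by rewrite exprn_ge0 // ltW.
Qed.

(** The limit is the infimum of [u n / n] over positive [n], whence the lower bound for every
    [n]. *)
Lemma fekete (R : realType) (u : nat -> R) :
  (forall n, 0 <= u n) -> (forall m n, u (m + n)%N <= u m + u n) ->
  exists d : R, [/\ 0 <= d, (fun n => u n / n%:R) @ \oo --> d &
                    forall n, d * n%:R <= u n].
Proof.
move=> u0 uD.
pose S : set R := [set u n.+1 / n.+1%:R | n in [set: nat]].
have S0 : S !=set0 by exists (u 1%N / 1); exists 0%N.
have lbS : lbound S 0 by move=> _ [n _ <-]; rewrite divr_ge0.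
have infS : has_inf S by split => //; exists 0.
pose d := inf S.
have d0 : 0 <= d by apply: lb_le_inf.
have dle n : d * n%:R <= u n.
  case: n => [|n]; first by rewrite mulr0.
  by rewrite -ler_pdivlMr ?ltr0n //; apply: ge_inf; [exists 0|exists n].
have uM q p : u (q * p)%N <= q%:R * u p + u 0%N.
  elim: q => [|q IH]; first by rewrite mul0n mul0r add0r.
  by rewrite mulSn; apply: le_trans (uD _ _) _; rewrite -natr1; lra.
have u1 m r : u (m + r)%N <= u m + r%:R * u 1%N.
  elim: r => [|r IH]; first by rewrite addn0 mul0r addr0.
  by rewrite addnS -addn1; apply: le_trans (uD _ _) _; rewrite -natr1; lra.
exists d; split => //; apply/cvgrPdist_le => e e0.
have [_ [p _ <-] pe] := @inf_adherent _ S (e / 2) ltac:(lra) infS.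
(* [C] pays for the remainder modulo [p.+1] and for [u 0], which subadditivity does not force to
   vanish. *)
pose C := p.+1%:R * u 1%N + u 0%N.
have C0 : 0 <= C by rewrite addr_ge0 ?mulr_ge0.
near=> n.
have n0 : (0 < n)%N by near: n; exact: nbhs_infty_gt.
have n0' : 0 < n%:R :> R by rewrite ltr0n.
have Cn : C <= e / 2 * n%:R.
  rewrite mulrC -ler_pdivrMr; last by lra.
  by near: n; apply: nbhs_infty_ger.
rewrite distrC ger0_norm; last by rewrite subr_ge0 ler_pdivlMr.
rewrite lerBlDl ler_pdivrMr //.
have := uM (n %/ p.+1)%N p.+1; have := u1 (n %/ p.+1 * p.+1)%N (n %% p.+1)%N.
rewrite -divn_eq => h1 h2.
have h3 : (n %% p.+1)%:R * u 1%N <= p.+1%:R * u 1%N.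
  by rewrite ler_wpM2r // ler_nat ltnW // ltn_mod.
have h4 : (n %/ p.+1)%:R * u p.+1 <= n%:R * (d + e / 2).
  have up : u p.+1 <= (d + e / 2) * p.+1%:R.
    by rewrite -ler_pdivrMr ?ltr0n //; apply: ltW.
  apply: le_trans (_ : (n %/ p.+1)%:R * ((d + e / 2) * p.+1%:R) <= _).
    by rewrite ler_wpM2l.
  rewrite mulrCA mulrC ler_wpM2r ?addr_ge0 //; first by lra.
  by rewrite -natrM ler_nat leq_divM.
rewrite /C in Cn; lra.
Unshelve. all: by end_near. Qed.

(** * Maximal density in a class of sets of times closed under shifts and under pointwise limits *)

Section MaximalDensity.
Variable C : set nat -> Prop.
Hypothesis C0 : C set0.
Hypothesis Cshift : forall J m, C J -> C [set t | J (m + t)%N].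
Hypothesis Clim : forall J,
  (forall n, exists2 J', C J' & forall t, (t < n)%N -> J t <-> J' t) -> C J.

Definition count_below (J : set nat) (n : nat) : nat := (\sum_(i < n) `[< J i >])%N.

Lemma count_below_le J n : (count_below J n <= n)%N.
Proof.
rewrite -[X in (_ <= X)%N](card_ord n) -sum1_card; apply: leq_sum => i _.
by case: `[< _ >].
Qed.

Lemma count_belowD J m n : count_below J (m + n) = (count_below J m + count_below [set t | J (m + t)%N] n)%N.
Proof. by rewrite /count_below big_split_ord. Qed.

Lemma eq_count_below J J' n : (forall t, (t < n)%N -> J t <-> J' t) ->
  count_below J n = count_below J' n.
Proof. by move=> JJ'; apply: eq_bigr => i _; rewrite (asbool_equiv_eq (JJ' i _)). Qed.

Let attained n m := `[< exists2 J, C J & count_below J n = m >].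

Let ex_attained n : exists m, attained n m.
Proof. by exists (count_below set0 n); apply/asboolP; exists set0. Qed.

Let attained_le n m : attained n m -> (m <= n)%N.
Proof. by move/asboolP => [J _ <-]; apply: count_below_le. Qed.

Definition max_count n := ex_maxn (ex_attained n) (@attained_le n).

Lemma count_below_le_max J n : C J -> (count_below J n <= max_count n)%N.
Proof.
move=> CJ; rewrite /max_count; case: ex_maxnP => m _; apply.
by apply/asboolP; exists J.
Qed.

Lemma max_countP n : exists2 J, C J & count_below J n = max_count n.
Proof. by rewrite /max_count; case: ex_maxnP => m /asboolP. Qed.

Lemma max_countD m n : (max_count (m + n) <= max_count m + max_count n)%N.
Proof.
have [J CJ <-] := max_countP (m + n).
by rewrite count_belowD leq_add ?count_below_le_max //; apply: Cshift.
Qed.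

Variable R : realType.

(* Otherwise every member of [C] splits into consecutive blocks of length at
   most [M] on each of which its density is below [d - e]. *)
Lemma dense_prefixes (d e : R) (M : nat) : 0 < e ->
  (forall n, d * n%:R <= (max_count n)%:R) ->
  exists2 J, C J & forall m, (m <= M)%N -> (d - e) * m%:R <= (count_below J m)%:R.
Proof.
move=> e0 dle; apply: contrapT => hn.
have bad J : C J -> exists m,
    [/\ (0 < m)%N, (m <= M)%N & (count_below J m)%:R < (d - e) * m%:R].
  move=> CJ; apply: contrapT => hJ; apply: hn; exists J => // m mM.
  rewrite leNgt; apply/negP => lt; apply: hJ; exists m; split => //.
  by case: m lt {mM} => //; rewrite mulr0 ltNge ler0n.
(* [K] absorbs the final block, of length at most [M]; the absolute value covers a negative
   [d - e]. *)
pose K := M%:R + `|d - e| * M%:R.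
have bound n : forall J, C J -> (count_below J n)%:R <= (d - e) * n%:R + K.
  elim/ltn_ind: n => n IH J CJ; have [nM|Mn] := leqP n M.
    have h1 : (count_below J n)%:R <= M%:R :> R.
      by rewrite ler_nat (leq_trans (count_below_le _ _)).
    have h2 : - (d - e) * n%:R <= `|d - e| * M%:R.
      apply: le_trans (_ : `|d - e| * n%:R <= _).
        by rewrite ler_wpM2r // -normrN ler_norm.
      by rewrite ler_wpM2l // ler_nat.
    by rewrite /K; lra.
  have [m [m0 mM lt]] := bad J CJ.
  have mn : (m <= n)%N by lia.
  have := IH (n - m)%N ltac:(lia) _ (Cshift m CJ).
  by rewrite -[in count_below J n](subnKC mn) count_belowD natrD natrB //; lra.
(* Once [e * n] exceeds [K], a set attaining [max_count n] contradicts [bound]. *)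
near \oo => n.
have : K < e * n%:R.
  rewrite mulrC -ltr_pdivrMr //; near: n; exact: nbhs_infty_gtr.
have [J CJ Jn] := max_countP n.
by have := bound n J CJ; have := dle n; rewrite Jn; lra.
Unshelve. all: by end_near. Qed.

(** [J'] collects the times lying in [J i] for almost every [i] along an ultrafilter containing the
    tails. Finite intersections settle a whole prefix at once, and the tails make [i] as large as
    desired. *)
Lemma ultra_limit (J : nat -> set nat) : (forall i, C (J i)) ->
  exists2 J', C J' &
    forall n i0, exists2 i, (i0 <= i)%N & forall t, (t < n)%N -> J' t <-> J i t.
Proof.
move=> CJ; have [F [UF ooF]] := ultraFilterLemma (F := \oo) _.
pose J' : set nat := [set t | F [set i | J i t]].
have Ft t : F [set i | J' t <-> J i t].
  have [h|h] := in_ultra_setVsetC [set i | J i t] UF.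
    by apply: filterS (h) => i Ji; split => // _; exact: h.
  apply: filterS (h) => i nJi; split => // h'.
  by have [j []] := filter_ex (filterI h h').
have key n i0 : exists2 i, (i0 <= i)%N & forall t, (t < n)%N -> J' t <-> J i t.
  have Fn : F [set i | forall t, (t < n)%N -> J' t <-> J i t].
    elim: n => [|n IH]; first by apply: filterE.
    apply: filterS2 IH (Ft n) => i h1 h2 t; rewrite ltnS leq_eqVlt.
    by move=> /orP[/eqP->|/h1].
  have Fi : F [set i | (i0 <= i)%N] by apply: ooF; exact: nbhs_infty_ge.
  by have [i [h1 h2]] := filter_ex (filterI Fn Fi); exists i.
exists J' => //; apply: Clim => n; have [i _ h] := key n 0%N; by exists (J i).
Qed.

Lemma maximal_density : exists d : R,
  [/\ (fun n => (max_count n)%:R / n%:R) @ \oo --> d &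
      exists2 J, C J & (fun n => (count_below J n)%:R / n%:R) @ \oo --> d].
Proof.
have [//|m n|d [d0 dcvg dle]] := @fekete R (fun n => (max_count n)%:R).
  by rewrite -natrD ler_nat max_countD.
exists d; split => //.
have /choice[J hJ] (i : nat) : exists J, C J /\
    forall m, (m <= i)%N -> (d - i.+1%:R^-1) * m%:R <= (count_below J m)%:R.
  by have [J CJ h] := @dense_prefixes d i.+1%:R^-1 i ltac:(by []) dle; exists J.
have [J' CJ' lim] := @ultra_limit J (fun i => (hJ i).1).
exists J' => //.
apply: (@squeeze_cvgr _ _ _ _ (fun=> d) (fun n => (max_count n)%:R / n%:R)) => //;
  last exact: cvg_cst.
near=> n.
have n0 : (0 < n)%N by near: n; exact: nbhs_infty_gt.
have n0' : 0 < n%:R :> R by rewrite ltr0n.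
rewrite ler_pdivlMr // ler_pM2r ?invr_gt0 // ler_nat count_below_le_max // andbT.
apply/ler_addgt0Pr => e e0.
near \oo => i0.
(* [i >= n] makes the bound on [J i] cover the prefix of length [n]; [i >= i0] makes its error at
   most [e]. *)
have [i ii agree] := lim n (maxn n i0).
have [_ /(_ n ltac:(lia))] := hJ i.
rewrite -(eq_count_below agree) => h.
have : i.+1%:R^-1 * n%:R <= e.
  rewrite -ler_pdivlMr // -[leRHS]invrK lef_pV2 ?posrE ?invr_gt0 ?divr_gt0 ?ltr0n //.
  apply: le_trans (_ : i0%:R <= _); last by rewrite ler_nat; lia.
  near: i0; exact: nbhs_infty_ger.
by move: h; rewrite mulrBl lerBlDr => h h'; apply: le_trans h _; rewrite lerD2l.
Unshelve. all: by end_near. Qed.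

End MaximalDensity.

(** * Covering numbers of joins and topological entropy *)

Section Covers.
Variable X : topologicalType.

(** [covnum] is a true minimum once a finite subcover exists; otherwise [xget] returns its default
    0. *)
Lemma subcover_covnum (U : set (set X)) m :
  subcover_of_size U m -> subcover_of_size U (covnum U) /\ (covnum U <= m)%N.
Proof.
move=> Um; have ex : exists n, `[< subcover_of_size U n >].
  by exists m; apply/asboolP.
have [n /asboolP Un nmin] := ex_minnP ex.
have [] := @xgetPex _ 0%N [set n | subcover_of_size U n /\
    forall m, subcover_of_size U m -> (n <= m)%N].
  by exists n; split => // p /asboolP; apply: nmin.
by move=> h1 h2; split => //; apply: h2.
Qed.

Variables (T : X -> X) (k : nat) (V : 'I_k -> set X).
Hypothesis k0 : (0 < k)%N.
Hypothesis Vcov : forall y, exists i, ~ V i y.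
Variable y0 : X.

Let U := [set ~` V i | i in [set: 'I_k]].
Let N n := covnum (join_iter T U n).

Definition pattern (t : nat) (j : 'I_k) : set X := [set y | V j (iter t T y)].

Lemma join_subcoverP n m : subcover_of_size (join_iter T U n) m <->
  exists w : 'I_m -> nat -> 'I_k, forall y, exists i,
    forall t, (t < n)%N -> ~ pattern t (w i t) y.
Proof.
split=> [[s [sU scov]]|[w wcov]]; last first.
  exists (fun i => \bigcap_(t in [set t | (t < n)%N]) (iter t T @^-1` ~` V (w i t))).
  split=> [i|y]; last by have [i wi] := wcov y; exists i => t /wi.
  by exists (fun t => ~` V (w i t)); split => // t _; exists (w i t).
have /choice[w hw] i : exists w : nat -> 'I_k,
    s i `<=` [set y | forall t, (t < n)%N -> ~ pattern t (w t) y].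
  have [f [fU ->]] := sU i.
  have /choice[w hw] t : exists j, (t < n)%N -> f t = ~` V j.
    have [tn|] := boolP (t < n)%N; last by exists (Ordinal k0).
    by have [j _ <-] := fU t tn; exists j.
  by exists w => y fy t tn; have := fy t tn; rewrite /= hw.
by exists w => y; have [i si] := scov y; exists i; apply: hw.
Qed.

Lemma covnum_join_le n (ws : seq {ffun 'I_n -> 'I_k}) :
  (forall y, exists2 w, w \in ws & forall t : 'I_n, ~ pattern t (w t) y) ->
  (N n <= size ws)%N.
Proof.
move=> wscov; apply: (subcover_covnum _).2; apply/join_subcoverP.
exists (fun i t => if insub t is Some t' then tnth (in_tuple ws) i t'
                   else Ordinal k0) => y.
have [w /seq_tnthP[i ->] hw] := wscov y; exists i => t tn.
by rewrite insubT; apply: (hw (Ordinal tn)).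
Qed.

(** There are finitely many words of length [n], and the one chosen by [c] along the orbit of [y]
    fits [y]. *)
Lemma covnum_join n : exists w : 'I_(N n) -> nat -> 'I_k,
  forall y, exists i, forall t, (t < n)%N -> ~ pattern t (w i t) y.
Proof.
apply/join_subcoverP; have /choice[c hc] := Vcov.
apply: (@subcover_covnum _ #|{: {ffun 'I_n -> 'I_k}}| _).1.
apply/join_subcoverP.
exists (fun i t => if insub t is Some t' then (enum_val i : {ffun 'I_n -> 'I_k}) t'
                   else Ordinal k0) => y.
exists (enum_rank [ffun t : 'I_n => c (iter t T y)]) => t tn.
by rewrite insubT enum_rankK ffunE; apply: hc.
Qed.

Lemma covnum_join_gt0 n : (0 < N n)%N.
Proof. by have [w /(_ y0)[i _]] := covnum_join n; apply: leq_trans (ltn_ord i). Qed.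

(** Words are concatenated: the first is chosen for [y], the second for [iter m T y]. *)
Lemma covnum_joinD m n : (N (m + n) <= N m * N n)%N.
Proof.
have [v vcov] := covnum_join m; have [w wcov] := covnum_join n.
have cardE : #|{: 'I_(N m) * 'I_(N n)}| = (N m * N n)%N.
  by rewrite card_prod !card_ord.
rewrite -cardE; apply: (subcover_covnum _).2; apply/join_subcoverP.
exists (fun p t => if (t < m)%N then v (enum_val p).1 t
                   else w (enum_val p).2 (t - m)%N) => y.
have [i vi] := vcov y; have [j wj] := wcov (iter m T y).
exists (enum_rank (i, j)) => t tmn; rewrite enum_rankK /=.
case: ltnP => [tm|mt]; first exact: vi.
have := wj (t - m)%N ltac:(lia).
by rewrite /pattern /= -iterD subnK.
Qed.

Lemma card_avoiding (n : nat) (E : {set 'I_n}) (w : 'I_n -> 'I_k) :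
  #|[set c : {ffun 'I_n -> 'I_k} | [forall t in E, c t != w t]]%SET|
    = (k.-1 ^ #|E| * k ^ (n - #|E|))%N.
Proof.
pose F (t : 'I_n) : pred 'I_k := fun j => (t \in E) ==> (j != w t).
have -> : #|[set c : {ffun 'I_n -> 'I_k} | [forall t in E, c t != w t]]%SET|
    = #|(family F : simpl_pred {ffun 'I_n -> 'I_k})|.
  by apply: eq_card => c; rewrite inE; apply/forallP/familyP.
rewrite card_family foldrE big_map big_enum /=.
rewrite (bigID (mem E)) /= (eq_bigr (fun=> k.-1)); last first.
  move=> t tE; rewrite -[in RHS](card_ord k) -(cardC1 (w t)).
  by apply: eq_card => j; rewrite unfold_in /F tE !inE.
rewrite prod_nat_const (eq_bigr (fun=> k)); last first.
  move=> t tE; rewrite -[RHS](card_ord k).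
  by apply: eq_card => j; rewrite unfold_in /F (negbTE tE).
rewrite prod_nat_const; congr (_ * _ ^ _)%N.
have <- : #|(~: E)%SET| = #|(fun t => t \notin E)|.
  by apply: eq_card => t; rewrite !inE.
by apply: (canRL (addKn _)); rewrite cardsC card_ord.
Qed.

(* A cover element given by a word [w] contains no point whose itinerary agrees
   with [w] somewhere on [E], so it accounts for a proportion [((k-1)/k)^#|E|]
   of the labellings of [E] only. *)
Lemma covnum_shatters n (E : {set 'I_n}) :
  shatters pattern setT E -> (k ^ #|E| <= N n * k.-1 ^ #|E|)%N.
Proof.
move=> Esh; have [w wcov] := covnum_join n.
have En : (#|E| <= n)%N by rewrite -[X in (_ <= X)%N]card_ord max_card.
(* The factor [k ^ (n - #|E|)] passes from labellings of [E] to labellings of all of ['I_n]. *)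
rewrite -(@leq_pmul2r (k ^ (n - #|E|))) ?expn_gt0 ?k0 // -expnD subnKC //.
rewrite -mulnA -[X in (k ^ X)%N](card_ord n) -[X in (X ^ _)%N](card_ord k).
rewrite -card_ffun -cardsT.
pose A i := [set c : {ffun 'I_n -> 'I_k} | [forall t in E, c t != w i t]]%SET.
apply: leq_trans (_ : #|(\bigcup_i A i)%SET| <= _)%N.
  apply/subset_leq_card/fintype.subsetP => c _; apply/finset.bigcupP.
  have [y _ hy] := Esh c; have [i wi] := wcov y; exists i => //.
  rewrite inE; apply/forallP => t; apply/implyP => tE; apply/eqP => ct.
  by apply: (wi t (ltn_ord t)); rewrite -ct; apply: hy.
apply: leq_trans (_ : \sum_i #|A i| <= _)%N.
  elim/big_ind2: _ => [|a A1 b B1 h1 h2|//]; first by rewrite cards0.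
  by apply: leq_trans (leq_card_setU _ _) _; apply: leq_add.
rewrite (eq_bigr (fun=> k.-1 ^ #|E| * k ^ (n - #|E|))%N) => [|i _].
  by rewrite sum_nat_const card_ord.
exact: card_avoiding.
Qed.

Variable R : realType.

Lemma htop_cover_cvg : exists h : R, [/\ 0 <= h, htop_cover R T U = h &
  (fun n => ln ((N n)%:R : R) / n%:R) @ \oo --> h].
Proof.
have N1 n : 0 < (N n)%:R :> R by rewrite ltr0n covnum_join_gt0.
have [n|m n|h [h0 hcvg _]] := @fekete R (fun n => ln (N n)%:R).
- by rewrite ln_ge0 // ler1n covnum_join_gt0.
- rewrite -lnM ?posrE // -natrM ler_ln ?posrE ?ltr0n ?muln_gt0 ?covnum_join_gt0 //.
  by rewrite ler_nat covnum_joinD.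
exists h; split => //; rewrite /htop_cover; exact: (cvg_lim _ hcvg).
Qed.

(** The window length [phi n] is left free to serve both [{0..n}] and, after translation,
    [{-n..n}]. *)
Lemma shatters_htop_pos (phi : nat -> nat) (E : forall n, {set 'I_(phi n)}) (d : R) :
  (1 < k)%N -> phi @ \oo --> \oo -> d != 0 ->
  (fun n => #|E n|%:R / (phi n)%:R) @ \oo --> d ->
  (forall n, shatters pattern setT (E n)) ->
  0 < htop_cover R T U.
Proof.
move=> k1 phioo dn0 Ecvg Esh; have [h [h0 -> hcvg]] := htop_cover_cvg.
have d0 : 0 < d.
  rewrite lt_neqAle eq_sym dn0; apply: (ler_cvg_to (cvg_cst 0) Ecvg).
  by apply: nearW => n; rewrite divr_ge0.
have p0 : 0 < k.-1%:R :> R by rewrite ltr0n; lia.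
pose L : R := ln (k%:R / k.-1%:R).
have q1 : 1 < k%:R / k.-1%:R :> R by rewrite ltr_pdivlMr // mul1r ltr_nat; lia.
have L0 : 0 < L by apply: ln_gt0.
have q0 : 0 < k%:R / k.-1%:R :> R by lra.
apply: lt_le_trans (mulr_gt0 d0 L0) _.
have lo : (fun n => #|E n|%:R / (phi n)%:R * L) @ \oo --> d * L.
  by apply: cvgM => //; apply: cvg_cst.
have up : (fun n => ln ((N (phi n))%:R : R) / (phi n)%:R) @ \oo --> h.
  exact: (cvg_comp _ _ phioo hcvg).
apply: (ler_cvg_to lo up).
apply: nearW => n /=; rewrite mulrAC ler_wpM2r ?invr_ge0 //.
rewrite mulr_natl -lnXn // ler_ln ?posrE ?exprn_gt0 ?ltr0n ?covnum_join_gt0 //.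
rewrite expr_div_n ler_pdivrMr ?exprn_gt0 // -!natrX -natrM ler_nat.
exact: covnum_shatters.
Qed.

End Covers.

(** * Independence sets and their existence under positive entropy *)

Section Independence.
Variables (X : topologicalType) (T : X -> X) (k : nat) (A : 'I_k -> set X).

Lemma finite_nat_bounded (I : set nat) : finite_set I ->
  exists n, forall t, I t -> (t < n)%N.
Proof.
move=> /finite_seqP[s ->]; exists (\max_(i <- s) i).+1 => t ts.
by rewrite ltnS; apply: (@leq_bigmax_seq _ _ predT id).
Qed.

Lemma indep_set0 : indep_set (act_nat T) A set0.
Proof. by move=> I _ [t It] /(_ t It). Qed.

Lemma indep_set_shift J m : indep_set (act_nat T) A J ->
  indep_set (act_nat T) A [set t | J (m + t)%N].
Proof.
move=> Ji I Ifin [t0 It0] IJ c.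
have [|||y hy] := Ji (addn m @` I) _ _ _ (fun s => c (s - m)%N).
- exact: finite_image.
- by exists (m + t0)%N; exists t0.
- by move=> _ [t /IJ Jt <-].
exists (iter m T y) => s Is.
have := hy (m + s)%N (ex_intro2 _ _ s Is erefl).
by rewrite /act_nat addKn addnC iterD.
Qed.

Lemma indep_set_lim J :
  (forall n, exists2 J', indep_set (act_nat T) A J' &
     forall t, (t < n)%N -> J t <-> J' t) ->
  indep_set (act_nat T) A J.
Proof.
move=> Jlim I Ifin I0 IJ c; have [n nI] := finite_nat_bounded Ifin.
have [J' J'i JJ'] := Jlim n; apply: J'i => // t It.
by apply/(JJ' t (nI t It))/IJ.
Qed.

Lemma indep_set_shatters J n : X -> indep_set (act_nat T) A J ->
  shatters (pattern T A) setT [set t : 'I_n | `[< J t >]]%SET.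
Proof.
move=> y0 Ji c; set E := finset _.
(* [indep_set] speaks only of nonempty sets, so an empty [E] is treated apart; [t0] also supplies a
   default label below. *)
have [E0|[t0 t0E]] := finset.set_0Vmem E.
  by exists y0 => // t; rewrite E0 inE.
pose I : set nat := [set (t : nat) | t in [set t | t \in E]].
have [|||y hy] := Ji I _ _ _ (fun s => if insub s is Some t then c t else c t0).
- by apply: finite_image; apply: finite_finset.
- by exists t0; exists t0.
- by move=> _ [t /= + <-]; rewrite inE => /asboolP.
exists y => // t tE; have := hy t (ex_intro2 _ _ t tE erefl).
by rewrite valK.
Qed.

Lemma shatters_indep_set n (E : {set 'I_n}) : shatters (pattern T A) setT E ->
  exists2 J, indep_set (act_nat T) A J & count_below J n = #|E|.
Proof.
move=> Esh; pose J : set nat := [set (t : nat) | t in [set t | t \in E]].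
exists J => [I _ _ IJ c|].
  have [y _ hy] := Esh (fun t => c t); exists y => s /IJ[t tE <-].
  exact: hy.
rewrite /count_below -sum1_card [RHS]big_mkcond; apply: eq_bigr => t _.
rewrite (_ : `[< J t >] = (t \in E)); first by case: (t \in E).
apply/asboolP/idP => [[u uE /val_inj <-//]|tE]; by exists t.
Qed.

Variable R : realType.

Lemma htop_pos_indep_set : X -> (1 < k)%N ->
  (forall j, exists j', A j `&` A j' = set0) ->
  0 < htop_cover R T [set ~` A i | i in [set: 'I_k]] ->
  exists2 J, indep_set (act_nat T) A J & pos_density_nat R J.
Proof.
move=> y0 k1 Adis; have k0 := ltnW k1.
have Acov y : exists i, ~ A i y.
  have [j jA] := Adis (Ordinal k0).
  have [Ay|] := pselect (A (Ordinal k0) y); last by exists (Ordinal k0).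
  by exists j => Aj; have : set0 y by rewrite -jA.
have [h [_ -> hcvg]] := htop_cover_cvg T k0 Acov y0 R => h0.
have [d [dmax [J Ji Jd]]] :=
  maximal_density indep_set0 indep_set_shift indep_set_lim R.
(* [pos_density_nat] divides the count on [{0..n}] by [n.+1], hence the shift by one. *)
exists J => //; exists d; last by rewrite -(cvg_shiftS _ (nbhs d)) in Jd.
apply/eqP => d0; rewrite {}d0 in dmax {Jd}.
(* Assuming [d = 0], [b] and then [q] make [ln b] and [a * q] at most [h / 3]; [g] lies strictly
   between [1 - 1/k] and 1, so some power of it drops below [b - 1]. *)
pose b := 1 + h / 3; have b1 : 1 < b by rewrite /b; lra.
have b0 : 0 < b by lra.
pose g : R := 1 - (2 * k%:R)^-1.
have kR : 0 < k%:R :> R by rewrite ltr0n.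
have g1 : `|g| < 1.
  have e0 : 0 < (2 * k%:R)^-1 :> R by rewrite invr_gt0 mulr_gt0.
  have e1 : (2 * k%:R)^-1 <= 2^-1 :> R.
    by rewrite lef_pV2 ?posrE ?mulr_gt0 // ler_peMr // ler1n.
  by rewrite ltr_norml /g; lra.
have gk : 1 - k%:R^-1 < g.
  by rewrite /g invfM ltrD2l ltrN2 gtr_pMl ?invr_gt0 //; lra.
have g0 : 0 <= g.
  apply: le_trans (ltW gk); rewrite subr_ge0 invf_le1 // ler1n //.
have [a ga] : exists a, g ^+ a <= b - 1.
  near \oo => a; exists a; apply: le_trans (ler_norm _) _.
  near: a; move/cvgr0Pnorm_le: (cvg_expr g1); apply; rewrite /b; lra.
pose q : R := Num.min 1 (h / 3 / a.+1%:R).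
have q0 : 0 < q by rewrite lt_min ltr01 !divr_gt0.
have q1 : q <= 1 by rewrite ge_min lexx.
have aq : a%:R * q <= h / 3.
  have : q <= h / 3 / a.+1%:R by rewrite ge_min lexx orbT.
  by rewrite ler_pdivlMr ?ltr0n // -natr1; lra.
pose L := - ln q.
have q2 : 0 < 1 + q by lra.
(* Logarithms of [N_n <= b^n * phi^a] and of [phi * q^m <= (1 + q)^n], where [m] is the maximal
   count. *)
have key n : ln (covnum (join_iter T [set ~` A i | i in [set: 'I_k]] n))%:R
    <= n%:R * (h / 3) + a%:R * (n%:R * q + (max_count indep_set0 n)%:R * L).
  have dis j : exists j', forall t y, pattern T A t j y -> ~ pattern T A t j' y.
    have [j' jj'] := Adis j; exists j' => t y h1 h2.
    by have : set0 (iter t T y) by rewrite -jj'.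
  have [ws wsb wscov] :=
    @cover_le_shattered X k n (pattern T A) R b g a k1 b1 g0 gk ga dis n setT (leqnn n).
  set phi := #|_| in wsb.
  have phi0 : 0 < phi%:R :> R.
    rewrite ltr0n card_gt0; apply/set0Pn; exists finset.set0; apply/shatteredP.
    by split=> [t|c]; [rewrite inE|exists y0 => // t; rewrite inE].
  have small : phi%:R * q ^+ max_count indep_set0 n <= (1 + q) ^+ n.
    apply: card_small_sets => // E /shatteredP[_ /shatters_indep_set[J' J'i <-]].
    exact: count_below_le_max.
  have N0 : 0 < (covnum (join_iter T [set ~` A i | i in [set: 'I_k]] n))%:R :> R.
    by rewrite ltr0n covnum_join_gt0.
  have : ln (covnum (join_iter T [set ~` A i | i in [set: 'I_k]] n))%:R
      <= ln (b ^+ n * phi%:R ^+ a).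
    rewrite ler_ln ?posrE ?mulr_gt0 ?exprn_gt0 //.
    apply: le_trans wsb; rewrite ler_nat; apply: covnum_join_le => // y.
    by have [w ww hw] := wscov y I; exists w => // t; apply: hw.
  rewrite lnM ?posrE ?exprn_gt0 // !lnXn //.
  have lnb : n%:R * ln b <= n%:R * (h / 3).
    by rewrite ler_wpM2l // le_ln1Dx //; lra.
  have lnphi : ln phi%:R <= n%:R * q + (max_count indep_set0 n)%:R * L.
    have : ln (phi%:R * q ^+ max_count indep_set0 n) <= ln ((1 + q) ^+ n).
      by rewrite ler_ln ?posrE ?mulr_gt0 ?exprn_gt0.
    rewrite lnM ?posrE ?exprn_gt0 // !lnXn // -[ln q *+ _]mulr_natl.
    rewrite -[ln (1 + q) *+ _]mulr_natl => le1.
    have le2 : n%:R * ln (1 + q) <= n%:R * q.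
      by rewrite ler_wpM2l // le_ln1Dx //; lra.
    by rewrite /L; lra.
  have := ler_wpM2l (ler0n R a) lnphi.
  rewrite -[ln b *+ n]mulr_natl -[ln _ *+ a]mulr_natl; lra.
have lim : (fun n => h / 3 + a%:R * q + a%:R * L * ((max_count indep_set0 n)%:R / n%:R))
    @ \oo --> h / 3 + a%:R * q + a%:R * L * 0.
  apply: cvgD; first exact: cvg_cst.
  by apply: cvgM => //; exact: cvg_cst.
(* With maximal density 0 the last term vanishes, leaving [h <= 2 * h / 3] against [h > 0]. *)
suff : h <= h / 3 + a%:R * q + a%:R * L * 0 by lra.
apply: (ler_cvg_to hcvg lim); near=> n.
have n0 : 0 < n%:R :> R by rewrite ltr0n; near: n; exact: nbhs_infty_gt.
rewrite ler_pdivrMr //; apply: le_trans (key n) _.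
rewrite le_eqVlt; apply/orP; left; apply/eqP; field; lra.
Unshelve. all: by end_near. Qed.

End Independence.

(** * Separation by closed neighbourhoods in compact Hausdorff spaces *)

Lemma closed_disjoint_nbhs (X : topologicalType) (k : nat) (x : 'I_k -> X)
    (U : 'I_k -> set X) :
  compact [set: X] -> hausdorff_space X -> (forall i, nbhs (x i) (U i)) ->
  exists V : X -> set X,
    [/\ forall i, closed (V (x i)), forall i, nbhs (x i) (V (x i)),
        forall i j, x i <> x j -> V (x i) `&` V (x j) = set0 &
        forall i, V (x i) `<=` U i].
Proof.
move=> Xc Xh Unbhs.
have /choice[sep hsep] (pq : X * X) : exists AB : set X * set X, pq.1 <> pq.2 ->
    [/\ nbhs pq.1 AB.1, nbhs pq.2 AB.2 & AB.1 `&` AB.2 = set0].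
  have [->|/eqP pq12] := pselect (pq.1 = pq.2); first by exists (set0, set0).
  move: Xh; rewrite open_hausdorff => /(_ _ _ pq12)[AB [xA yB] [oA oB /eqP AB0]].
  by exists AB; split => //; apply: open_nbhs_nbhs; split => //; apply/set_mem.
(* [sep] depends on the order of a pair, so both orders are imposed: for [x i <> x j], [W (x i)] and
   [W (x j)] then lie in the two halves of the same [sep (x i, x j)]. *)
pose W p : set X := [set y | forall j, (x j = p -> U j y) /\
  (x j <> p -> (sep (p, x j)).1 y /\ (sep (x j, p)).2 y)].
have Wnbhs p : nbhs p (W p).
  apply: filter_forall => j; have [jp|jp] := pselect (x j = p).
    by have := Unbhs j; rewrite jp; apply: filterS => y Uy.
  have [h1 _ _] := hsep (p, x j) (fun e => jp (esym e)); have [_ h2 _] := hsep (x j, p) jp.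
  by apply: filterS2 h1 h2 => y.
have /choice[B hB] p : exists B, nbhs p B /\ closure B `<=` W p.
  have reg : {for p, regular_space X} by apply: (compact_regular Xh Xc); apply: filterT.
  by have [B] := reg _ (Wnbhs p); exists B.
exists (closure \o B); split => [i|i|i j xij|i y] /=.
- exact: closed_closure.
- by apply: filterS (hB (x i)).1; apply: subset_closure.
- rewrite -subset0 => y [/(hB (x i)).2 Wi /(hB (x j)).2 Wj].
  have [_ /(_ (fun e => xij (esym e)))[sij _]] := Wi j.
  have [_ /(_ xij)[_ sij']] := Wj i.
  by have [_ _ <-] := hsep (x i, x j) xij.
- by move=> /(hB (x i)).2 /(_ i)[+ _]; apply.
Qed.

Lemma card_set_asbool n (P : nat -> Prop) :
  #|[set t : 'I_n | `[< P t >]]%SET| = (\sum_(t < n) `[< P t >])%N.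
Proof.
rewrite -sum1_card big_mkcond; apply: eq_bigr => t _.
by rewrite inE; case: `[< _ >].
Qed.

(** * Entropy tuples and IE-tuples, over the naturals and the integers *)

Section IEtuples.
Variables (R : realType) (X : topologicalType) (T : X -> X).
Variables (k : nat) (x : 'I_k -> X).
Hypothesis k1 : (1 < k)%N.
Hypothesis xneq : ~ (forall i j, x i = x j).

Lemma exists_neq i : exists j, x i <> x j.
Proof.
apply: contrapT => /forallNP h; apply: xneq => a b.
by transitivity (x i); [apply/esym|]; apply: contrapT; apply: h.
Qed.

Let i0 : 'I_k := Ordinal (ltnW k1).

Lemma disjoint_cover (V : X -> set X) :
  (forall i j, x i <> x j -> V (x i) `&` V (x j) = set0) ->
  forall y, exists i, ~ V (x i) y.
Proof.
move=> Vdis y; have [j xj] := exists_neq i0.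
have [Vi|] := pselect (V (x i0) y); last by exists i0.
by exists j => Vj; have : set0 y by rewrite -(Vdis _ _ xj).
Qed.

(** The entropy hypothesis needs closed disjoint neighbourhoods, so the [U i] are shrunk;
    independence then passes back to the larger sets. *)
Lemma entropy_IE_nat : compact [set: X] -> hausdorff_space X ->
  entropy_tuple R T x -> IE_tuple (act_nat T) (pos_density_nat R) x.
Proof.
move=> Xc Xh [_ ent] U Unbhs.
have [V [Vc Vn Vd VU]] := closed_disjoint_nbhs Xc Xh Unbhs.
have [|J Ji Jd] := @htop_pos_indep_set X T k (V \o x) R (x i0) k1 _ (ent V Vc Vn Vd).
  by move=> j; have [j' /Vd] := exists_neq j; exists j'.
exists J; split => // I If I0 IJ c; have [y hy] := Ji I If I0 IJ c.
by exists y => s /hy /VU.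
Qed.

Lemma IE_nat_entropy :
  IE_tuple (act_nat T) (pos_density_nat R) x -> entropy_tuple R T x.
Proof.
move=> ie; split => // V Vc Vn Vd.
have [J [Ji [d d0 Jd]]] := ie (V \o x) Vn.
pose E n := [set t : 'I_n.+1 | `[< J t >]]%SET.
apply: (@shatters_htop_pos X T k (V \o x) (ltnW k1) (disjoint_cover Vd) (x i0) R
  succn E d) => //.
- exact: (cvg_addnl 1).
- apply: cvg_trans Jd; apply: near_eq_cvg; apply: nearW => n.
  by rewrite card_set_asbool.
- by move=> n; apply: indep_set_shatters Ji; exact: x i0.
Qed.

Variable Tinv : X -> X.
Hypothesis TinvK : cancel Tinv T.

(** Starting the forward orbit at [iter n Tinv y] turns the window [{-n..n}] into the times
    [{0..2n}]. *)
Lemma iter_act_int n t y :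
  iter t T (iter n Tinv y) = act_int T Tinv (t%:Z - n%:Z) y.
Proof.
have iterK m z : iter m T (iter m Tinv z) = z.
  by elim: m z => // m IH z; rewrite iterS (iterSr _ Tinv) IH TinvK.
have [nt|tn] := leqP n t.
  by rewrite subzn //= -{1}(subnK nt) iterD iterK.
have -> : t%:Z - n%:Z = Negz (n - t).-1 by rewrite NegzE; lia.
by rewrite /act_int prednK ?subn_gt0 // -{1}(subnKC (ltnW tn)) iterD iterK.
Qed.

Lemma IE_int_entropy :
  IE_tuple (act_int T Tinv) (pos_density_int R) x -> entropy_tuple R T x.
Proof.
move=> ie; split => // V Vc Vn Vd.
have [J [Ji [d d0 Jd]]] := ie (V \o x) Vn.
pose E n := [set t : 'I_(2 * n).+1 | `[< J (t%:Z - n%:Z)%R >]]%SET.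
apply: (@shatters_htop_pos X T k (V \o x) (ltnW k1) (disjoint_cover Vd) (x i0) R
  (fun n => (2 * n).+1) E d) => //.
- exact: (cvg_comp (muln 2) succn (@cvg_mulnl 2 isT) (cvg_addnl 1)).
- apply: cvg_trans Jd; apply: near_eq_cvg; apply: nearW => n.
  by rewrite (card_set_asbool _ (fun t => J (t%:Z - n%:Z)%R)).
move=> n c; have [E0|[t0 t0E]] := finset.set_0Vmem (E n).
  by exists (x i0) => // t; rewrite E0 inE.
pose I : set int := [set (t%:Z - n%:Z)%R | t in [set t : 'I_(2 * n).+1 | t \in E n]].
(* Adding [n] to an integer time of the window recovers its index in [E n]. *)
have [|||y hy] := Ji I _ _ _ (fun s => c (inord (absz (s + n%:Z)))).
- by apply: finite_image; apply: finite_finset.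
- by exists (t0%:Z - n%:Z)%R; exists t0.
- by move=> _ [t /= + <-]; rewrite inE => /asboolP.
exists (iter n Tinv y) => // t tE.
have := hy _ (ex_intro2 _ _ t tE erefl).
by rewrite /pattern /= iter_act_int subrK /= inord_val.
Qed.

Lemma IE_nat_int : IE_tuple (act_nat T) (pos_density_nat R) x ->
  IE_tuple (act_int T Tinv) (pos_density_int R) x.
Proof.
move=> ie U Un; have [J [Ji [d d0 Jd]]] := ie U Un.
exists (Posz @` J); split=> [I If [s0 Is0] IJ c|].
  have [|||y hy] := Ji (Posz @^-1` I) _ _ _ (c \o Posz).
  - by apply: finite_preimage => // a b _ _ [].
  - by have [t Jt ts] := IJ _ Is0; exists t; rewrite /= ts.
  - by move=> t /IJ[u Ju [<-]].
  by exists y => s Is; have [t Jt ts] := IJ _ Is; rewrite -ts in Is *; apply: hy.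
exists (d * 2^-1); first by rewrite mulf_neq0 // invr_neq0 // pnatr_eq0.
(* This is the ratio [(n + 1) / (2n + 1)] of the two window lengths, split as [1/2] plus half of
   [1 / (2n + 1)]. *)
have half : (fun n => 2^-1 + 2^-1 * harmonic (2 * n)%N : R) @ \oo --> (2^-1 : R).
  rewrite -[X in _ --> X]addr0 -[X in _ --> _ + X](mulr0 2^-1).
  apply: cvgD; first exact: cvg_cst.
  apply: cvgM; first exact: cvg_cst.
  exact: (cvg_comp (muln 2) harmonic (@cvg_mulnl 2 isT) cvg_harmonic).
apply: cvg_trans (cvgM Jd half); apply: near_eq_cvg; apply: nearW => n.
have -> : (\sum_(i < (2 * n).+1) `[< (Posz @` J) (i%:Z - n%:Z)%R >])%N
    = (\sum_(i < n.+1) `[< J i >])%N.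
  rewrite -(big_mkord xpredT (fun i => nat_of_bool `[< (Posz @` J) (i%:Z - n%:Z)%R >])).
  rewrite (@big_cat_nat _ _ _ n) //=; last by lia.
  rewrite big_nat big1 ?add0n => [|i /andP[_ lin]]; last first.
    by rewrite asboolF // => -[t Jt ti]; lia.
  rewrite -{1}[n]add0n big_addn (_ : (2 * n).+1 - n = n.+1)%N; last by lia.
  rewrite big_mkord; apply: eq_bigr => i _; congr nat_of_bool.
  rewrite PoszD addrK; apply/asboolP/asboolP => [[t Jt [<-//]]|Jt]; by exists i.
rewrite /harmonic /= -[(2 * n).+1%:R]natr1 -[n.+1%:R]natr1 natrM.
have n0 : 0 <= n%:R :> R by [].
by field; lra.
Qed.

End IEtuples.

Theorem theorem3p16 (R : realType) (X : topologicalType) (T : X -> X) :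
  compact [set: X] -> hausdorff_space X -> continuous T ->
  (forall y : X, exists x : X, T x = y) ->
  forall (k : nat) (x : 'I_k -> X), (2 <= k)%N -> ~ (forall i j, x i = x j) ->
  (entropy_tuple R T x <-> IE_tuple (act_nat T) (pos_density_nat R) x) /\
  (forall Tinv : X -> X, continuous Tinv -> cancel T Tinv -> cancel Tinv T ->
     (entropy_tuple R T x <-> IE_tuple (act_int T Tinv) (pos_density_int R) x)).
Proof.
move=> Xc Xh _ _ k x k1 xneq; split; first split.
- exact: entropy_IE_nat.
- exact: IE_nat_entropy.
move=> Tinv _ _ TinvK; split; last exact: IE_int_entropy.
by move/(entropy_IE_nat k1 xneq Xc Xh); apply: IE_nat_int.
Qed.
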